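(* Let $A$ be a positive odd number and let $p_i$, $q_i$, and $f_i$ ($i\ge 0$) denote the subsequences of odd numbers in the reverse Collatz sequences of $A$, $2A+1$, and $4A+1$, respectively (so $p_0=A$, $q_0=2A+1$, $f_0=4A+1$). 1. If $A\equiv 0\bmod 3$, write $A=3^nB$ with $n\ge1$ and $B$ an odd number with $B\not\equiv 0\bmod 3$. Then, for $i=1,2,\dots,n$, $q_i=2^{2i+1}(3^{n-i}B)+1$ and $f_i=2^{2i+2}(3^{n-i}B)+1$. If $B\equiv 1\bmod 3$, then $q_n\equiv 0\bmod 3$. On the other hand, if $B\equiv 2\bmod 3$, then $f_n\equiv 0\bmod 3$. 2. If $A\not\equiv 0\bmod 3$, then there is some $k\ge 1$ for which the following conditions hold. (a) $p_k\not\equiv 2\bmod 3$. If $p_k\equiv 1\bmod 3$, then $p_k=3n+1$ and $p_{k+1}=4n+1$ for some even number $n$. (b) If $A\equiv 1\bmod 3$, then the reverse Collatz sequence of $2A+1$ is trivial, the reverse Collatz sequences of both $A$ and $4A+1$ are not trivial, and $f_i=2p_i+1$ for $1\le i\le k$. If $p_k\equiv 0\bmod 3$, then $f_{k+1}=2^3\left(\frac{p_k}{3}\right)+1$. On the other hand, if $p_k\equiv 1\bmod 3$, then $f_k\equiv 0\bmod 3$. (c) If $A\equiv 2\bmod 3$, then $4A+1\equiv 0\bmod 3$ and the reverse Collatz sequence of $4A+1$ is trivial, the reverse Collatz sequences of both $A$ and $2A+1$ are not trivial, and $q_i=2p_i+1$ for $0\le i\le k$. If $p_k\equiv 0\bmod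 3$, then $q_{k+1}=2^3\left(\frac{p_k}{3}\right)+1$. On the other hand, if $p_k\equiv 1\bmod 3$, then $q_k\equiv 0\bmod 3$.
   Context: The reverse Collatz sequence $r_i$ of a positive integer $A$ is defined by $r_0=A$ and, for $i\ge 1$: $r_i=\frac{r_{i-1}-1}{3}$ if $r_{i-1}$ is even and $r_{i-1}\equiv 1\bmod 3$; $r_i=2r_{i-1}$ if $r_{i-1}$ is even and $r_{i-1}\not\equiv 1\bmod 3$; $r_i=2r_{i-1}$ if $r_{i-1}$ is odd. The subsequence of odd numbers consists of the odd terms $r_i$ in order, indexed from $0$; for an odd starting number the index-$0$ term is the starting number. This subsequence may be finite, in which case terms beyond its last one do not exist; an asserted equality or congruence for a term includes the assertion that the term exists. The reverse Collatz sequence of an odd number $A$ is trivial if the starting term $r_0=A$ is the only odd term in it (i.e. there is no odd term with index $1$). *)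

(* Defs.v *)
From mathcomp Require Import all_boot.

Set Implicit Arguments.
Unset Strict Implicit.
Unset Printing Implicit Defensive.

(* The division is exact, and its result odd, whenever it is performed. *)
Definition rcollatz_step (r : nat) : nat :=
  if odd r then 2 * r
  else if r %% 3 == 1 then (r - 1) %/ 3
  else 2 * r.

Definition rcollatz (A i : nat) : nat := iter i rcollatz_step A.

(* [odd_term A i x]: the subsequence of odd terms of the reverse Collatz
   sequence of A has a term of index i, and this term is x. The position j of
   that term is the one preceded by exactly i odd terms. The subsequence may be
   finite, hence a functional relation instead of a total function. *)
Definition odd_term (A i x : nat) : Prop :=
  exists j : nat,
    [/\ rcollatz A j = x, odd x & count odd (mkseq (rcollatz A) j) = i].

Definition trivial_rcollatz (A : nat) : Prop := ~ exists x, odd_term A 1 x.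

Lemma odd_term0 (A : nat) : odd A -> odd_term A 0 A.
Proof. by move=> oddA; exists 0. Qed.

Lemma odd_term_inj (A i x y : nat) :
  odd_term A i x -> odd_term A i y -> x = y.
Proof.
have cnt_lt j l : j < l -> odd (rcollatz A j) ->
    count odd (mkseq (rcollatz A) j) < count odd (mkseq (rcollatz A) l).
  move=> lt_jl oddj; rewrite -(subnKC lt_jl) /mkseq iotaD map_cat count_cat.
  by rewrite -[j.+1]addn1 iotaD map_cat count_cat /= add0n oddj !addn1 leq_addr.
case=> j [<- oddj <-] [l [<- oddl]].
case: (ltngtP j l) => [/cnt_lt|/cnt_lt|-> //].
- by move=> /(_ oddj) lt_cnt eq_cnt; rewrite eq_cnt ltnn in lt_cnt.
by move=> /(_ oddl) lt_cnt eq_cnt; rewrite eq_cnt ltnn in lt_cnt.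
Qed.

(* Main.v *)
Require Import Defs.
From mathcomp Require Import all_boot.
From mathcomp Require Import zify.

(** On odd terms the reverse Collatz map acts by 3m+1 -> 4m+1 and
    3m+2 -> 2m+1, and stops at multiples of 3. The first rule turns 3C+1 into
    4C+1, so each step from 2A+1 or 4A+1 with A = 3^n B trades a factor 3 for
    a factor 4. The second rule commutes with x -> 2x+1 and decreases x; hence
    once two sequences are related by x -> 2x+1 they stay so until the first
    term that is not 2 mod 3, which must occur. *)

Lemma rcollatzS (A j : nat) : rcollatz A j.+1 = rcollatz_step (rcollatz A j).
Proof. by []. Qed.

Lemma count_mkseqS (T : Type) (a : pred T) (f : nat -> T) (n : nat) :
  count a (mkseq f n.+1) = count a (mkseq f n) + a (f n).
Proof. by rewrite mkseqS -cats1 count_cat /= addn0. Qed.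

(** The path is 3m+1, 2(3m+1), 4(3m+1), 4m+1: the first double is 2 mod 3 and so is doubled again,
    while 4(3m+1) - 1 = 3(4m+1). *)
Lemma odd_termS1 (A i m : nat) :
  odd_term A i (3 * m + 1) -> odd_term A i.+1 (4 * m + 1).
Proof.
case=> j [rj oddx cj].
have rj1 : rcollatz A j.+1 = 2 * (3 * m + 1).
  by rewrite rcollatzS rj /rcollatz_step oddx.
have rj2 : rcollatz A j.+2 = 4 * (3 * m + 1).
  rewrite rcollatzS rj1 /rcollatz_step.
  by rewrite ifF ?ifF; lia.
exists j.+3; split; last 1 first.
- rewrite !count_mkseqS rj rj1 rj2 oddx cj; lia.
- rewrite rcollatzS rj2 /rcollatz_step.
  by rewrite ifF ?ifT; lia.
- lia.
Qed.

(** One doubling suffices here: 2(3m+2) is 1 mod 3, and 2(3m+2) - 1 = 3(2m+1). *)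
Lemma odd_termS2 (A i m : nat) :
  odd_term A i (3 * m + 2) -> odd_term A i.+1 (2 * m + 1).
Proof.
case=> j [rj oddx cj].
have rj1 : rcollatz A j.+1 = 2 * (3 * m + 2).
  by rewrite rcollatzS rj /rcollatz_step oddx.
exists j.+2; split; last 1 first.
- rewrite !count_mkseqS rj rj1 oddx cj; lia.
- rewrite rcollatzS rj1 /rcollatz_step.
  by rewrite ifF ?ifT; lia.
- lia.
Qed.

(** Doubling preserves divisibility by 3, so the division branch is never taken. *)
Lemma rcollatz_mod3_eq0 (A : nat) :
  A %% 3 = 0 -> forall j, rcollatz A j = 2 ^ j * A.
Proof.
move=> A3; elim=> [|j IHj]; first by rewrite mul1n.
have r3 : (2 ^ j * A) %% 3 = 0 by rewrite -modnMmr A3 muln0.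
rewrite rcollatzS IHj /rcollatz_step r3 /=.
by rewrite if_same mulnA expnS.
Qed.

Lemma trivial_rcollatz_mod3_eq0 (A : nat) : A %% 3 = 0 -> trivial_rcollatz A.
Proof.
move=> A3 [x [[|j] [rj oddx cj]]] //.
by move: oddx; rewrite -rj rcollatz_mod3_eq0 // oddM oddX.
Qed.

Lemma odd_term_nontrivial (A x : nat) :
  odd_term A 1 x -> ~ trivial_rcollatz A.
Proof. by move=> A1x; apply; exists x. Qed.

(** Used with [C] equal to 2B for 2A+1 and to 4B for 4A+1. *)
Lemma odd_term_pow3 (C n : nat) :
  forall A, odd_term A 0 (C * 3 ^ n + 1) ->
  forall i, i <= n -> odd_term A i (2 ^ (2 * i) * (C * 3 ^ (n - i)) + 1).
Proof.
move=> A A0; elim=> [|i IHi] le_in; first by rewrite muln0 mul1n subn0.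
have e3 : 3 ^ (n - i) = 3 * 3 ^ (n - i.+1) by rewrite -expnS; congr (3 ^ _); lia.
have e2 : 2 ^ (2 * i.+1) = 4 * 2 ^ (2 * i) by rewrite mulnS expnD.
have := IHi (ltnW le_in); rewrite e3 e2.
set a := 2 ^ _; set b := 3 ^ _.
have -> : a * (C * (3 * b)) + 1 = 3 * (a * (C * b)) + 1 by nia.
by move/odd_termS1; rewrite !mulnA.
Qed.

(** The start index [i] is free because the induction on [p] advances it. Both uses start at index
    1, which gives k >= 1. *)
Lemma odd_term_double_chain (A C p i : nat) :
  odd_term A i p -> odd_term C i (2 * p + 1) ->
  exists k pk : nat,
    [/\ i <= k, odd_term A k pk, pk %% 3 <> 2
      & forall j, i <= j <= k ->
          exists2 pj, odd_term A j pj & odd_term C j (2 * pj + 1)].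
Proof.
have [N] := ubnP p; elim: N p i => // N IHN p i ltpN Aip Cip.
have [p3|/eqP p3] := eqVneq (p %% 3) 2; last first.
  exists i, p; split=> // j /andP[le_ij le_ji].
  by have -> : j = i; [lia | exists p].
have [m pE] : exists m, p = 3 * m + 2 by exists (p %/ 3); lia.
rewrite {p}pE in p3 ltpN Aip Cip.
(* With p = 3m+2, 2p+1 is also 2 mod 3; the successors are 2m+1 < p and 2(2m+1)+1. *)
have Cip' : odd_term C i (3 * (2 * m + 1) + 2).
  by have <- : 2 * (3 * m + 2) + 1 = 3 * (2 * m + 1) + 2 by lia.
have [|k [pk [le_ik Akpk pk3 chain]]] :=
    IHN _ _ _ (odd_termS2 _ _ _ Aip) (odd_termS2 _ _ _ Cip').
  lia.
exists k, pk; split=> // [|j /andP[le_ij le_jk]]; first lia.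
have [<-|ne_ij] := eqVneq i j; first by exists (3 * m + 2).
by apply: chain; lia.
Qed.

Lemma odd_term_mod3_eq1 (A k p : nat) :
  odd_term A k p -> p %% 3 = 1 ->
  exists n, [/\ ~~ odd n, p = 3 * n + 1 & odd_term A k.+1 (4 * n + 1)].
Proof.
move=> Akp p3; have [n pE] : exists n, p = 3 * n + 1 by exists (p %/ 3); lia.
rewrite {p}pE in p3 Akp *.
exists n; split=> //; last exact: odd_termS1.
by case: Akp => j [_ oddp _]; lia.
Qed.

(** When 3 divides p, 2p+1 has the form 3m+1 with m = 2(p/3). *)
Lemma odd_term_double_mod3_eq0 (C k p : nat) :
  odd_term C k (2 * p + 1) -> p %% 3 = 0 ->
  odd_term C k.+1 (2 ^ 3 * (p %/ 3) + 1).
Proof.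
move=> Ckp p3; have -> : 2 ^ 3 * (p %/ 3) = 4 * (2 * (p %/ 3)) by lia.
apply: odd_termS1.
by have <- : 2 * p + 1 = 3 * (2 * (p %/ 3)) + 1 by lia.
Qed.

Theorem theorem3p1 (A : nat) (A_gt0 : 0 < A) (A_odd : odd A) :
  (A = 0 %[mod 3] ->
     forall n B : nat, 1 <= n -> odd B -> B <> 0 %[mod 3] -> A = 3 ^ n * B ->
     [/\ forall i : nat, 1 <= i <= n ->
           odd_term (2 * A + 1) i (2 ^ (2 * i + 1) * (3 ^ (n - i) * B) + 1) /\
           odd_term (4 * A + 1) i (2 ^ (2 * i + 2) * (3 ^ (n - i) * B) + 1),
         B = 1 %[mod 3] ->
           exists2 qn, odd_term (2 * A + 1) n qn & qn = 0 %[mod 3]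
       & B = 2 %[mod 3] ->
           exists2 fn, odd_term (4 * A + 1) n fn & fn = 0 %[mod 3]])
  /\
  (A <> 0 %[mod 3] ->
     exists k pk : nat, 1 <= k /\ odd_term A k pk /\
     [/\ (* (a) *)
         pk <> 2 %[mod 3] /\
         (pk = 1 %[mod 3] ->
            exists n : nat,
              [/\ ~~ odd n, pk = 3 * n + 1 & odd_term A k.+1 (4 * n + 1)]),
         (* (b) *)
         A = 1 %[mod 3] ->
           trivial_rcollatz (2 * A + 1) /\
           ~ trivial_rcollatz A /\
           ~ trivial_rcollatz (4 * A + 1) /\
           (forall i : nat, 1 <= i <= k ->
              exists2 pi, odd_term A i pi
                        & odd_term (4 * A + 1) i (2 * pi + 1)) /\
           (pk = 0 %[mod 3] ->
              odd_term (4 * A + 1) k.+1 (2 ^ 3 * (pk %/ 3) + 1)) /\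
           (pk = 1 %[mod 3] ->
              exists2 fk, odd_term (4 * A + 1) k fk & fk = 0 %[mod 3])
       & (* (c) *)
         A = 2 %[mod 3] ->
           4 * A + 1 = 0 %[mod 3] /\
           trivial_rcollatz (4 * A + 1) /\
           ~ trivial_rcollatz A /\
           ~ trivial_rcollatz (2 * A + 1) /\
           (forall i : nat, 0 <= i <= k ->
              exists2 pi, odd_term A i pi
                        & odd_term (2 * A + 1) i (2 * pi + 1)) /\
           (pk = 0 %[mod 3] ->
              odd_term (2 * A + 1) k.+1 (2 ^ 3 * (pk %/ 3) + 1)) /\
           (pk = 1 %[mod 3] ->
              exists2 qk, odd_term (2 * A + 1) k qk & qk = 0 %[mod 3])]).
Proof.
split=> [A3 n B n_gt0 oddB B3 AE | A3].
  have AE2 : 2 * A + 1 = 2 * B * 3 ^ n + 1 by rewrite AE; lia.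
  have AE4 : 4 * A + 1 = 4 * B * 3 ^ n + 1 by rewrite AE; lia.
  have q i : i <= n ->
      odd_term (2 * A + 1) i (2 ^ (2 * i + 1) * (3 ^ (n - i) * B) + 1).
    (* The surplus factor 2 is absorbed into the constant [C] of [odd_term_pow3]; for [f] it is
       4. *)
    have -> : 2 ^ (2 * i + 1) * (3 ^ (n - i) * B)
              = 2 ^ (2 * i) * (2 * B * 3 ^ (n - i)).
      by rewrite (expnD _ _ 1) -mulnA (mulnC _ B) !mulnA.
    by apply: odd_term_pow3; rewrite -AE2; apply: odd_term0; lia.
  have f i : i <= n ->
      odd_term (4 * A + 1) i (2 ^ (2 * i + 2) * (3 ^ (n - i) * B) + 1).
    have -> : 2 ^ (2 * i + 2) * (3 ^ (n - i) * B)
              = 2 ^ (2 * i) * (4 * B * 3 ^ (n - i)).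
      by rewrite (expnD _ _ 2) -mulnA (mulnC _ B) !mulnA.
    by apply: odd_term_pow3; rewrite -AE4; apply: odd_term0; lia.
  (* Hence modulo 3 the terms of index n are 2B+1 and 4B+1, which vanish for B = 1 and B = 2
     respectively. *)
  have pow4 m : 2 ^ (2 * m) %% 3 = 1 by rewrite expnM -modnXm exp1n.
  split=> [i /andP[_ le_in] | B1 | B2]; first by split; [apply: q | apply: f].
    exists (2 ^ (2 * n + 1) * (3 ^ (n - n) * B) + 1); first exact: q.
    rewrite subnn mul1n (expnD _ _ 1) -mulnA -modnDml -modnMml pow4; lia.
  exists (2 ^ (2 * n + 2) * (3 ^ (n - n) * B) + 1); first exact: f.
  rewrite subnn mul1n (expnD _ _ 2) -mulnA -modnDml -modnMml pow4; lia.
have A0 := odd_term0 A_odd.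
have Q0 : odd_term (2 * A + 1) 0 (2 * A + 1) by apply: odd_term0; lia.
have F0 : odd_term (4 * A + 1) 0 (4 * A + 1) by apply: odd_term0; lia.
have [m [AE|AE]] : exists m, A = 3 * m + 1 \/ A = 3 * m + 2.
  by exists (A %/ 3); lia.
- have A1 : odd_term A 1 (4 * m + 1) by apply: odd_termS1; rewrite -AE.
  (* The doubling relation with the sequence of A begins only at index 1: the terms of index 0 are A
     and 4A+1. *)
  have F1 : odd_term (4 * A + 1) 1 (2 * (4 * m + 1) + 1).
    apply: odd_termS2.
    by have <- : 4 * A + 1 = 3 * (4 * m + 1) + 2 by lia.
  have [k [pk [k_gt0 Ak pk3 chain]]] := odd_term_double_chain _ _ _ _ A1 F1.
  have [|p Akp Fk] := chain k; first lia.
  (* Uniqueness of the term of index k identifies the [p] supplied by the chain with [pk]. *)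
  have {p Akp} Fk : odd_term (4 * A + 1) k (2 * pk + 1).
    by rewrite (odd_term_inj Ak Akp).
  exists k, pk; do 2?split=> //; split; last lia.
    by split=> //; apply: odd_term_mod3_eq1.
  move=> _; split; first by apply: trivial_rcollatz_mod3_eq0; lia.
  split; first exact: odd_term_nontrivial A1.
  split; first exact: odd_term_nontrivial F1.
  split=> //; split=> pkE; first exact: odd_term_double_mod3_eq0.
  (* If [pk] is 1 mod 3, then 2pk+1 is divisible by 3. *)
  by exists (2 * pk + 1) => //; lia.
- have A1 : odd_term A 1 (2 * m + 1) by apply: odd_termS2; rewrite -AE.
  (* Here the relation already holds at index 0, but the chain is started at index 1 to ensure k >=
     1. *)
  have Q1 : odd_term (2 * A + 1) 1 (2 * (2 * m + 1) + 1).
    apply: odd_termS2.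
    by have <- : 2 * A + 1 = 3 * (2 * m + 1) + 2 by lia.
  have [k [pk [k_gt0 Ak pk3 chain]]] := odd_term_double_chain _ _ _ _ A1 Q1.
  have [|p Akp Qk] := chain k; first lia.
  have {p Akp} Qk : odd_term (2 * A + 1) k (2 * pk + 1).
    by rewrite (odd_term_inj Ak Akp).
  exists k, pk; do 2?split=> //; split; [|lia|].
    by split=> //; apply: odd_term_mod3_eq1.
  move=> _; have F3 : (4 * A + 1) %% 3 = 0 by lia.
  split=> //; split; first exact: trivial_rcollatz_mod3_eq0.
  split; first exact: odd_term_nontrivial A1.
  split; first exact: odd_term_nontrivial Q1.
  (* Index 0 lies outside the chain and is settled by the starting terms A and 2A+1. *)
  split=> [[_|i le_ik]|]; [by exists A | exact: chain |].
  split=> pkE; first exact: odd_term_double_mod3_eq0.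
  by exists (2 * pk + 1) => //; lia.
Qed.
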